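(* Let $L_{\mathcal C}=\{ww\mid w\in\{0,1\}^*\}$ be the binary copy-language. Then every graph is $L_{\mathcal C}$-representable.
   Context: Graphs are finite, undirected and simple: $G=(V,E)$ with $V$ a finite non-empty set and $E\subseteq\binom{V}{2}$. A language $L\subseteq\{0,1\}^*$ is $0$-$1$-symmetric if it is invariant under the morphism exchanging $0$ and $1$ (the language here is). For distinct letters $u,v$ of an alphabet $V$, $h_{u,v}:V^*\to\{0,1\}^*$ is the monoid morphism with $u\mapsto 0$, $v\mapsto 1$, and $x\mapsto\lambda$ (empty word) for all other letters $x$. For a $0$-$1$-symmetric $L$ and a word $w\in V^*$ in which every letter of $V$ occurs, $G(L,w)$ is the graph with vertex set $V$ in which distinct $u,v$ are adjacent if and only if $h_{u,v}(w)\in L$. A graph $G=(V,E)$ is $L$-representable if $G=G(L,w)$ for some $w\in V^*$ in which every letter of $V$ occurs. *)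

(* Defs.v *)
From HB Require Import structures.
From mathcomp Require Import all_boot boolp.

Set Implicit Arguments.
Unset Strict Implicit.
Unset Printing Implicit Defensive.

(* A simple graph on V is a set of 2-element subsets of V.  The side condition
   is boolean, so equality of graphs is equality of edge sets. *)
Record sgraph (V : finType) := SGraph {
  edges :> {set {set V}};
  _ : [forall e in edges, #|e| == 2] }.

HB.instance Definition _ (V : finType) := [isSub for @edges V].

(* Binary words are of type [seq bool]: the letter 0 is [false], 1 is [true]. *)
Definition language := seq bool -> Prop.

Definition symmetric01 (L : language) : Prop :=
  forall x : seq bool, L (map negb x) <-> L x.

Record symlanguage := SymLanguage {
  lang :> seq bool -> Prop;
  lang_sym : symmetric01 lang }.

Definition hletter (V : eqType) (u v x : V) : seq bool :=
  if x == u then [:: false] else if x == v then [:: true] else [::].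

Definition h (V : eqType) (u v : V) (w : seq V) : seq bool :=
  flatten (map (hletter u v) w).

(* Membership in L is a proposition; it is decided classically. *)
Definition word_edges (V : finType) (L : language) (w : seq V) :
    {set {set V}} :=
  [set e : {set V} |
    `[< exists u v : V, [/\ u != v, e = [set u; v] & L (h u v w)] >]].

Lemma word_edges_card (V : finType) (L : language) (w : seq V) :
  [forall e in word_edges L w, #|e| == 2].
Proof.
apply/forall_inP => e; rewrite inE => /asboolP [u [v [uv -> _]]].
by rewrite cards2 uv.
Qed.

Definition word_graph (V : finType) (L : symlanguage) (w : seq V) : sgraph V :=
  SGraph (word_edges_card L w).

Lemma h_swap (V : eqType) (u v : V) (w : seq V) :
  u != v -> h v u w = map negb (h u v w).
Proof.
move=> uv; rewrite /h map_flatten -map_comp; congr flatten.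
apply: eq_map => x; rewrite /= /hletter.
by case: (eqVneq x u) => [->|_]; [rewrite (negPf uv) | case: (x == v)].
Qed.

(* The symmetry of L makes adjacency independent of the order of u and v. *)
Lemma word_graphP (V : finType) (L : symlanguage) (w : seq V) (u v : V) :
  u != v -> ([set u; v] \in edges (word_graph L w)) <-> L (h u v w).
Proof.
move=> uv; rewrite inE; split=> [/asboolP [a [b [ab eab Lab]]]|Luv]; last first.
  by apply/asboolP; exists u, v.
have: u \in [set a; b] by rewrite -eab set21.
have: v \in [set a; b] by rewrite -eab set22.
rewrite !inE => /orP[]/eqP ev /orP[]/eqP eu; subst u v => //.
- by rewrite eqxx in uv.
- by rewrite h_swap //; apply/lang_sym.
- by rewrite eqxx in uv.
Qed.

Definition representable (L : symlanguage) (V : finType) (G : sgraph V) : Prop :=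
  exists w : seq V, (forall x : V, x \in w) /\ G = word_graph L w.

Definition copy_lang : language := fun x => exists w : seq bool, x = w ++ w.

Lemma copy_lang_sym : symmetric01 copy_lang.
Proof.
have neg x : copy_lang x -> copy_lang (map negb x).
  by move=> [w ->]; exists (map negb w); rewrite map_cat.
by move=> x; split=> [/neg|/neg//]; rewrite (mapK negbK).
Qed.

Definition copy_language : symlanguage := SymLanguage copy_lang_sym.

(* Main.v *)
(* Let w1 list all vertices and then the word uv for every ordered pair (u, v)
   with {u, v} not an edge, and let w2 be w1 with each of these words reversed.
   Since w1 and w2 have the same letter counts, h a b (w1 w2) is a square if and
   only if h a b w1 = h a b w2.  A word uv and its reversal vu have the same
   projection to {a, b} unless {u, v} = {a, b}, so equality holds exactly when
   {a, b} is an edge. *)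
Require Import Defs.
From mathcomp Require Import all_boot.

Definition pair_word {T : Type} (P : seq (T * T)) : seq T :=
  flatten [seq [:: p.1; p.2] | p <- P].

Definition swap_pairs {T : Type} (P : seq (T * T)) : seq (T * T) :=
  [seq (p.2, p.1) | p <- P].

Lemma h_cat (T : eqType) (a b : T) (x y : seq T) :
  h a b (x ++ y) = h a b x ++ h a b y.
Proof. by rewrite /h map_cat flatten_cat. Qed.

Lemma size_h_perm (T : eqType) (a b : T) (x y : seq T) :
  perm_eq x y -> size (h a b x) = size (h a b y).
Proof. by move=> xy; apply/perm_size/perm_flatten/perm_map. Qed.

Lemma perm_pair (T : eqType) (x y : T) : perm_eq [:: x; y] [:: y; x].
Proof. by have := permEl (perm_catC [:: x] [:: y]). Qed.

Lemma perm_pair_word_swap (T : eqType) (P : seq (T * T)) :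
  perm_eq (pair_word P) (pair_word (swap_pairs P)).
Proof.
elim: P => // p P IH; apply: (@perm_cat _ [:: _; _] [:: _; _]) IH.
exact: perm_pair.
Qed.

(** Unless [p] is [(a, b)] or [(b, a)], some letter of [p] is erased or its two letters coincide, so
    reversal does not change the projection. The two exceptions give 01 and 10. *)
Lemma h_pair_swap (T : eqType) (a b : T) (p : T * T) : a != b ->
  (h a b [:: p.1; p.2] == h a b [:: p.2; p.1]) = (p != (a, b)) && (p != (b, a)).
Proof.
case: p => u v ab; rewrite /h /= /hletter !xpair_eqE.
have ba : b == a = false by rewrite eq_sym (negPf ab).
case: (eqVneq u a) => [->|ua]; case: (eqVneq v a) => [->|va];
  rewrite ?(negPf ab) ?ba //=.
- by case: (v == b).
- by case: (u == b).
- by case: (u == b); case: (v == b).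
Qed.

(** Corresponding blocks have projections of equal length, so the equality splits block by block and
    no block can compensate for another. *)
Lemma h_pair_word_swap (T : eqType) (a b : T) (P : seq (T * T)) : a != b ->
  (h a b (pair_word P) == h a b (pair_word (swap_pairs P)))
  = ((a, b) \notin P) && ((b, a) \notin P).
Proof.
move=> ab; elim: P => // p P IH.
rewrite -[pair_word (p :: P)]/([:: p.1; p.2] ++ pair_word P).
rewrite -[pair_word (swap_pairs _)]/([:: p.2; p.1] ++ pair_word (swap_pairs P)).
rewrite (h_cat _ _ _ [:: p.1; _]) (h_cat _ _ _ [:: p.2; _]) eqseq_cat; last first.
  by exact/size_h_perm/perm_pair.
by rewrite h_pair_swap // IH !inE !negb_or ![p == _]eq_sym andbACA.
Qed.

(** Equal lengths put the junction of [x] and [y] at the midpoint of the square. *)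
Lemma copy_lang_cat (x y : seq bool) :
  size x = size y -> copy_lang (x ++ y) <-> x = y.
Proof.
move=> sxy; split=> [[z xyzz]|->]; last by exists y.
have sxz : size x = size z.
  have := congr1 size xyzz.
  by rewrite !size_cat -sxy !addnn => /double_inj.
by move/eqP: xyzz; rewrite eqseq_cat // => /andP[/eqP-> /eqP->].
Qed.

Theorem theorem15 (V : finType) (V_nonempty : 0 < #|V|) (G : sgraph V) :
  representable copy_language G.
Proof.
(* Diagonal pairs [(x, x)] are included, since a singleton is no edge; they are harmless, as [xx] is
   its own reversal. *)
pose P := [seq p <- enum {: V * V} | [set p.1; p.2] \notin edges G].
pose w1 := enum V ++ pair_word P.
pose w2 := enum V ++ pair_word (swap_pairs P).
exists (w1 ++ w2); split=> [x|]; first by rewrite !mem_cat mem_enum.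
have edgeP a b : a != b ->
    ([set a; b] \in edges G)
    = ([set a; b] \in edges (word_graph copy_language (w1 ++ w2))).
  move=> ab; have inP u v : ((u, v) \notin P) = ([set u; v] \in edges G).
    by rewrite mem_filter mem_enum andbT negbK.
  have -> : ([set a; b] \in edges G) = (h a b w1 == h a b w2).
    rewrite !h_cat eqseq_cat // eqxx h_pair_word_swap // !inP.
    by rewrite [[set b; a]]setUC andbb.
  have sz : size (h a b w1) = size (h a b w2).
    by apply: size_h_perm; rewrite perm_cat2l perm_pair_word_swap.
  have copyP := copy_lang_cat _ _ sz; rewrite -h_cat in copyP.
  apply/eqP/idP => [/copyP|] hab; first exact/word_graphP.
  exact/copyP/(word_graphP copy_language _ ab).
apply/val_inj/setP => e /=.
(* Two-element sets are settled by [edgeP]; any other set is an edge of neither graph. *)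
have card2 (H : sgraph V) : e \in edges H -> #|e| == 2.
  by case: H => E /= /forall_inP; apply.
have [/cards2P[a [b [ab ->]]]|ne2] := boolP (#|e| == 2); first exact: edgeP.
have notin (H : sgraph V) : (e \in edges H) = false.
  by apply: contraNF ne2; apply: card2.
by rewrite notin (notin (word_graph copy_language (w1 ++ w2))).
Qed.
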